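(* Let $n\ge 2$ and $k\ge 0$ be integers. For all $a,b\in\mathbb Z_{2n-1}$ and every $\pi\in M_{2n,k}$, the permutation $\phi(a,b,\pi)$ defined by $\phi(a,b,\pi)(x)=\pi(x-a)+b$ (for $x\in\mathbb Z_{2n-1}$) again belongs to $M_{2n,k}$.
   Context: Permutations $\pi\in S_N$ are bijections of $\mathbb Z_N$, written $[\pi(1)\ \pi(2)\ \cdots\ \pi(N)]$, with entries represented by $1,\dots,N$. For an entry $k$ its left pointer is $(k-1,k)$ and its right pointer is $(k,k+1)$. The pointer word $W(\pi)$ is the sequence $L(\pi(1))\,R(\pi(1))\,L(\pi(2))\,R(\pi(2))\cdots L(\pi(N))\,R(\pi(N))$ with the entries $(0,1)$ and $(N,N+1)$ removed; each pointer $(p,p+1)$, $1\le p\le N-1$, occurs exactly twice. Two distinct pointers $p,q$ form a valid pointer context (are compatible) if their occurrences in $W(\pi)$ appear in the order $p\ldots q\ldots p\ldots q$ or $q\ldots p\ldots q\ldots p$. Strategic pile: regarding entries as integers, let $X_N=(0\ 1\ 2\ \cdots\ N)$ and $Y_\pi=(\pi(N)\ \pi(N-1)\ \cdots\ \pi(1)\ 0)$ in cycle notation on $\{0,\dots,N\}$, and $C_\pi=Y_\pi\circ X_N$; $\mathrm{SP}(\pi)$ is the set of numbers appearing after $N$ and before $0$ in the cycle of $C_\pi$ containing $0$ and $N$ (empty if $0$ and $N$ lie in different cycles). A permutation $\pi\in S_{2n}$ has maximal strategic pile if $|\mathrm{SP}(\pi)|=2n-1$; for such $\pi$, the entry $2n$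 is immediately followed by $1$. The contraction of such $\pi$ is the permutation $\pi'\in S_{2n-1}$ obtained by deleting the entry $2n$ (entries after it move one place left), viewed as a bijection of $\mathbb Z_{2n-1}$; its pointers are those of $\pi$, except that the pointer $(2n-1,2n)$ is renamed $(2n-1,1)$ (it is the right pointer of $2n-1$ and the left pointer of $1$). $M_{2n,k}$ denotes the set of contractions of permutations in $S_{2n}$ with maximal strategic pile and exactly $k$ valid pointer contexts. *)

(* Defs.v *)
From mathcomp Require Import all_boot all_order all_algebra all_fingroup.

Set Implicit Arguments.
Unset Strict Implicit.
Unset Printing Implicit Defensive.

Import GRing.Theory.
Local Open Scope ring_scope.

(* S_N is {perm 'Z_N}.  This is meaningful for N >= 2 only, since 'Z_0 and    *)
(* 'Z_1 are both Z/2.                                                         *)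

(* The representative in 1, ..., N of a residue mod N; 0 is written N.        *)
Definition label (N : nat) (r : 'Z_N) : nat :=
  if r == 0 then N else nat_of_ord r.

Definition oneline (N : nat) (s : {perm 'Z_N}) : seq nat :=
  [seq label (s i%:R) | i <- iota 1 N].

Definition left_pointer (k : nat) : nat * nat := (k.-1, k).
Definition right_pointer (k : nat) : nat * nat := (k, k.+1).

Definition pointer_word (N : nat) (s : {perm 'Z_N}) : seq (nat * nat) :=
  [seq p <- flatten [seq [:: left_pointer k; right_pointer k] | k <- oneline s]
     | (p != (0, 1)%N) && (p != (N, N.+1))].

Definition valid_pointer_context (N : nat) (s : {perm 'Z_N})
    (p q : nat * nat) : bool :=
  let occ := [seq r <- pointer_word s | (r == p) || (r == q)] in
  (p != q) && ((occ == [:: p; q; p; q]) || (occ == [:: q; p; q; p])).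

(* A context is an unordered pair of pointers (i, i+1), (j, j+1) with         *)
(* 1 <= i, j <= N - 1, hence counted once, with i < j.                        *)
Definition num_contexts (N : nat) (s : {perm 'Z_N}) : nat :=
  #|[set c : 'I_N * 'I_N | (0 < c.1 < c.2)%N
       && valid_pointer_context s (right_pointer c.1) (right_pointer c.2)]|.

(* [next c] is the cyclic permutation written c in cycle notation.            *)
Definition cycleX (N : nat) : 'I_N.+1 -> 'I_N.+1 :=
  next [seq inord i | i <- iota 0 N.+1].

Definition cycleY (N : nat) (s : {perm 'Z_N}) : 'I_N.+1 -> 'I_N.+1 :=
  next [seq inord i | i <- rcons (rev (oneline s)) 0%N].

Definition breakpoint_perm (N : nat) (s : {perm 'Z_N}) : 'I_N.+1 -> 'I_N.+1 :=
  cycleY s \o @cycleX N.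

(* [orbit f x] lists the cycle of x under f, starting from x.                 *)
Definition strategic_pile (N : nat) (s : {perm 'Z_N}) : {set 'I_N.+1} :=
  let c := fingraph.orbit (breakpoint_perm s) ord_max in
  if ord0 \in c then [set x in behead (take (index ord0 c) c)] else set0.

Definition max_strategic_pile (n : nat) (s : {perm 'Z_(2 * n)}) : bool :=
  #|strategic_pile s| == (2 * n - 1)%N.

Definition is_contraction (n : nat) (s : {perm 'Z_(2 * n)})
    (t : {perm 'Z_(2 * n - 1)}) : bool :=
  oneline t == rem (2 * n)%N (oneline s).

Definition M (n k : nat) : {set {perm 'Z_(2 * n - 1)}} :=
  [set t | [exists s : {perm 'Z_(2 * n)},
     [&& max_strategic_pile s, num_contexts s == k & is_contraction s t]]].

Lemma phi_inj (N : nat) (a b : 'Z_N) (s : {perm 'Z_N}) :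
  injective (fun x : 'Z_N => s (x - a) + b).
Proof. by move=> x y /addIr/perm_inj/addIr. Qed.

Definition phi (N : nat) (a b : 'Z_N) (s : {perm 'Z_N}) : {perm 'Z_N} :=
  perm (@phi_inj N a b s).

(* Main.v *)
Require Import Defs.
From mathcomp Require Import all_boot all_order all_algebra all_fingroup.
From mathcomp Require Import zify.

(** Let t in S_m, m = 2n - 1, be a contraction.  It has a unique expansion in
    which m + 1 immediately precedes 1, and both conditions defining [M] can be
    read off t as a bijection of Z/m.  Splicing 0 and m + 1 out of the breakpoint
    permutation of the expansion leaves r |-> t (t^-1 (r + 1) - 1) on Z/m, so the
    pile is maximal iff that map is a single cycle.  The pointer word of the
    expansion, with pointer (p, p + 1) renamed p mod m, is the word of the pairs
    t i - 1, t i, and interlacing of two letters depends on this word only up to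
    rotation.  Replacing t by [phi a b t] conjugates the map by translation by b,
    rotates the word, and adds b to its letters, so neither condition changes. *)

Set Implicit Arguments.
Unset Strict Implicit.
Unset Printing Implicit Defensive.

Import GRing.Theory.
Local Open Scope ring_scope.

(** * Residues, their representatives, and one-line notation *)

Lemma label_gt0 N (r : 'Z_N) : (1 < N)%N -> (0 < label r)%N.
Proof.
move=> hN; rewrite /label; case: eqP => [_|/eqP r0]; first lia.
by rewrite lt0n; apply: contraNneq r0 => r0; apply/eqP/val_inj.
Qed.

Lemma label_le N (r : 'Z_N) : (1 < N)%N -> (label r <= N)%N.
Proof.
move=> hN; rewrite /label; case: eqP => // _.
by have := ltn_ord r; rewrite [X in (_ < X)%N -> _]Zp_cast // => /ltnW.
Qed.

Lemma labelK N : (1 < N)%N -> cancel (@label N) (fun i => i%:R).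
Proof.
move=> hN r; rewrite /label; case: eqP => [->|_]; last exact: natr_Zp.
exact: pchar_Zp.
Qed.

Lemma label_inj N : (1 < N)%N -> injective (@label N).
Proof. by move=> /labelK/can_inj. Qed.

Lemma label_natr N i : (1 < N)%N -> (0 < i <= N)%N -> label (i%:R : 'Z_N) = i.
Proof.
move=> hN /andP[i0 iN]; rewrite /label -val_eqE /= val_Zp_nat //.
have [->|ne] := eqVneq i N; first by rewrite modnn.
have lt : (i < N)%N by rewrite ltn_neqAle ne.
by rewrite modn_small // -[_ == _]/(i == 0%N) eqn0Ngt i0.
Qed.

Lemma oneline_uniq N (s : {perm 'Z_N}) : (1 < N)%N -> uniq (oneline s).
Proof.
move=> hN; rewrite map_inj_in_uniq ?iota_uniq // => i j.
rewrite !mem_iota => hi hj /(label_inj hN)/perm_inj e.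
by have := congr1 (@label N) e; rewrite !label_natr //; lia.
Qed.

Lemma mem_oneline N (s : {perm 'Z_N}) i :
  (1 < N)%N -> (i \in oneline s) = (0 < i <= N)%N.
Proof.
move=> hN; apply/mapP/idP => [[j _ ->]|hi].
  by rewrite label_gt0 ?label_le.
exists (label ((s^-1)%g i%:R)).
  by rewrite mem_iota add1n ltnS label_gt0 ?label_le.
by rewrite labelK // permKV label_natr.
Qed.

Lemma oneline_onto N (w : seq nat) : (1 < N)%N -> perm_eq w (iota 1 N) ->
  exists s : {perm 'Z_N}, oneline s = w.
Proof.
move=> hN pw; have sw : size w = N by rewrite (perm_size pw) size_iota.
have uw : uniq w by rewrite (perm_uniq pw) iota_uniq.
have mw i : (i < N)%N -> (0 < nth 0%N w i <= N)%N.
  move=> hi; have : nth 0%N w i \in w by rewrite mem_nth ?sw.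
  by rewrite (perm_mem pw) mem_iota.
(* Positions run from 1 to [N], with residue 0 standing for [N], while [nth] counts from 0; hence
   the predecessor. *)
pose f (r : 'Z_N) : 'Z_N := (nth 0%N w (label r).-1)%:R.
have lf (r : 'Z_N) : ((label r).-1 < N)%N.
  by have := label_gt0 r hN; have := label_le r hN; lia.
have fI : injective f.
  move=> x y /(congr1 (@label N)); rewrite /f !label_natr ?mw // => /eqP.
  rewrite nth_uniq ?sw // => /eqP e; apply: (label_inj hN).
  by have := label_gt0 x hN; have := label_gt0 y hN; lia.
exists (perm fI); apply: (@eq_from_nth _ 0%N); rewrite size_map size_iota ?sw //.
move=> i hi; rewrite (nth_map 0%N) ?size_iota // nth_iota // permE /f.
by rewrite !(@label_natr N) ?add1n ?hi // mw.
Qed.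

(** * Predecessors in cyclic lists *)

Lemma prev_cat_cons (T : eqType) (x y : T) u v :
  x \notin u -> prev (y :: u ++ x :: v) x = last y u.
Proof.
(* In [prev_at], [y0] is the fixed head and [y] the element just passed; the induction needs them to
   vary separately. *)
suff H y0 : x \notin u -> prev_at x y0 y (u ++ x :: v) = last y u by exact: H.
elim: u y => [|z u IHu] y /=.
  by rewrite eqxx.
by rewrite inE => /norP[/negPf-> /IHu].
Qed.

Lemma prev_cons_head (T : eqType) (y : T) u :
  y \notin u -> prev (y :: u) y = last y u.
Proof.
suff H z : y \notin u -> prev_at y y z u = last z u by exact: H.
elim: u z => [|t u IHu] z /=.
  by rewrite eqxx.
by rewrite inE => /norP[/negPf-> /IHu].
Qed.

Lemma iotaSr m n : iota m n.+1 = rcons (iota m n) (m + n)%N.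
Proof. by rewrite -addn1 iotaD cats1. Qed.

Lemma last_iota m : last 0%N (iota 1 m) = m.
Proof. by case: m => // m; rewrite iotaSr last_rcons. Qed.

(** * The breakpoint permutation and the strategic pile *)

(** The cycle [Y] lists 0 and the entries backwards, so its successor map is the predecessor map of
    [0 :: oneline s]; [X] adds one and wraps from [N] to 0. *)
Lemma val_breakpoint N (s : {perm 'Z_N}) (x : 'I_N.+1) : (1 < N)%N ->
  breakpoint_perm s x = prev (0%N :: oneline s)
    (if x == N :> nat then 0%N else x.+1) :> nat.
Proof.
move=> hN.
(* [inord] is faithful on entries at most [N], so both cycles can be treated as lists of
   naturals. *)
have K c : all (fun i => i <= N)%N c ->
    [seq val j | j <- [seq (inord i : 'I_N.+1) | i <- c]] = c.
  move=> /allP h; rewrite -map_comp -[RHS]map_id; apply/eq_in_map => i /h hi /=.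
  by rewrite inordK.
rewrite /breakpoint_perm /= /cycleY /cycleX -rev_cons.
rewrite -(next_map val_inj); last first.
  by rewrite -(map_inj_uniq val_inj) K ?rev_uniq /= ?oneline_uniq ?mem_oneline //;
    rewrite all_rev /=; apply/allP => i; rewrite mem_oneline // => /andP[].
rewrite K; last first.
  rewrite all_rev /=; apply/allP => i; rewrite mem_oneline // => /andP[] //.
rewrite next_rev; last by rewrite /= oneline_uniq // mem_oneline.
have Ui : uniq (iota 0 N.+1) by exact: iota_uniq.
congr prev; rewrite -(next_map val_inj); last first.
  by rewrite -(map_inj_uniq val_inj) K //; apply/allP => i; rewrite mem_iota; lia.
rewrite K; last by apply/allP => i; rewrite mem_iota; lia.
(* The value of [next] is verified by applying its inverse [prev], for which the lemmas above are
   available. *)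
apply: (canLR (next_prev Ui)); case: eqP => [e|/eqP ne].
  by rewrite [val x]e prev_cons_head ?mem_iota // last_iota.
have lx : (x < N)%N by rewrite ltn_neqAle ne -ltnS /=.
have -> : iota 0 N.+1 = 0%N :: iota 1 x ++ x.+1 :: iota x.+2 (N - x.+1).
  by rewrite /= -{1}(subnKC lx) addSnnS iotaD.
by rewrite prev_cat_cons ?last_iota // mem_iota; lia.
Qed.

Lemma breakpoint_inj N (s : {perm 'Z_N}) : (1 < N)%N -> injective (breakpoint_perm s).
Proof.
move=> hN.
have U c : all (fun i => i <= N)%N c -> uniq c ->
    uniq [seq (inord i : 'I_N.+1) | i <- c].
  move=> /allP h; rewrite map_inj_in_uniq // => i j /h hi /h hj /(congr1 val) /=.
  by rewrite !inordK.
apply: inj_comp; apply: can_inj (prev_next _); apply: U.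
- rewrite all_rcons all_rev /=; apply/allP => i; rewrite mem_oneline // => /andP[] //.
- by rewrite -rev_cons rev_uniq /= oneline_uniq // mem_oneline.
- by apply/allP => i; rewrite mem_iota; lia.
- exact: iota_uniq.
Qed.

(** The pile has one element fewer than the index of 0 in the orbit of [N]. An orbit has at most
    [N + 1] elements, so size [N - 1] puts 0 in the last place of an orbit that exhausts everything,
    and the next step returns to [N]. *)
Lemma card_strategic_pile_max N (s : {perm 'Z_N}) : (1 < N)%N ->
  #|strategic_pile s| = N.-1 <->
    breakpoint_perm s ord0 = ord_max /\
    (forall x, fconnect (breakpoint_perm s) ord_max x).
Proof.
move=> hN; rewrite /strategic_pile; have Cinj := @breakpoint_inj _ s hN.
set C := breakpoint_perm s in Cinj *; set c := fingraph.orbit C ord_max.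
have uc : uniq c by exact: orbit_uniq.
have sc : size c = fingraph.order C ord_max by exact: size_orbit.
have card_pile : #|[set x in behead (take (index ord0 c) c)]| = (index ord0 c).-1.
  rewrite cardsE (card_uniqP _) ?drop1 ?size_behead ?size_take_min.
    by congr _.-1; apply/minn_idPl; exact: index_size.
  by rewrite -drop1 drop_uniq // take_uniq.
have leN : (fingraph.order C ord_max <= N.+1)%N.
  by rewrite -[X in (_ <= X)%N]card_ord max_card.
split=> [|[C0 conn]].
  case: ifP => [c0|_]; last by rewrite cards0; lia.
  rewrite card_pile => iN; have := c0; rewrite -index_mem sc => lt.
  have i_eq : index ord0 c = N by lia.
  have oN : fingraph.order C ord_max = N.+1 by lia.
  have full x : fconnect C ord_max x.
    have /subset_cardP/(_ (subset_predT _)) : #|fconnect C ord_max| = #|'I_N.+1|.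
      by rewrite card_ord.
    by move/(_ x).
  split=> //; have := iter_order Cinj ord_max; rewrite oN iterS.
  by have := iter_findex (full ord0); rewrite /findex -/c i_eq => ->.
have c0 : ord0 \in c by rewrite -fconnect_orbit.
rewrite c0 card_pile; congr _.-1.
have oN : fingraph.order C ord_max = N.+1.
  by rewrite -[RHS]card_ord; apply: eq_card => x; rewrite inE; exact: conn.
(* Were 0 reached before index [N], its image [ord_max] would recur inside the orbit at a positive
   index. *)
have := c0; rewrite -index_mem sc oN ltnS leq_eqVlt => /predU1P[//|lt].
have := @findex_iter _ C ord_max (index ord0 c).+1.
rewrite oN ltnS iterS -/(findex C ord_max ord0) iter_findex // C0 findex0.
by move=> /(_ lt).
Qed.

(** * The pile condition as a condition on the contraction *)

(** The breakpoint rule without the extra points: one up in value, then one to the left in position,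
    both cyclically. *)
Definition breakpoint_cyc N (t : {perm 'Z_N}) (r : 'Z_N) : 'Z_N :=
  t ((t^-1)%g (r + 1) - 1).

(** A step to the left from position 1 meets the leading 0, where the cyclic step would give [t 0];
    this is the only discrepancy between the two. *)
Lemma prev_oneline N (t : {perm 'Z_N}) (r : 'Z_N) : (1 < N)%N ->
  prev (0%N :: oneline t) (label (t r)) = if r == 1 then 0%N else label (t (r - 1)).
Proof.
move=> hN; have := label_gt0 r hN; have := label_le r hN.
rewrite -{3 4 5}(labelK hN r); set i := label r => iN i0.
have -> : oneline t = [seq label (t j%:R) | j <- iota 1 i.-1] ++
    label (t i%:R) :: [seq label (t j%:R) | j <- iota i.+1 (N - i)].
  have -> : oneline t =
      [seq label (t j%:R) | j <- iota 1 i.-1 ++ i :: iota i.+1 (N - i)].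
    congr map; have -> : N = (i.-1 + (N - i).+1)%N by lia.
    by rewrite iotaD /= add1n prednK //; congr (_ ++ _ :: iota _ _); lia.
  by rewrite map_cat.
rewrite prev_cat_cons; last first.
  apply/mapP => -[j]; rewrite mem_iota => hj /(label_inj hN)/perm_inj.
  move=> /(congr1 (@label N)); rewrite !label_natr; lia.
have [i1|i1] := eqVneq i 1%N; first by rewrite i1 eqxx.
have -> : (i%:R == 1 :> 'Z_N) = false.
  apply/eqP => /(congr1 (@label N)); rewrite -[1 in RHS]/(1%:R) !label_natr //; lia.
case: i i0 iN i1 => [|[|i]] // _ iN _.
by rewrite succnK iotaSr map_rcons last_rcons add1n -[i.+2%:R]natr1 addrK.
Qed.

Lemma last_oneline N (t : {perm 'Z_N}) : (1 < N)%N ->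
  last 0%N (oneline t) = label (t 0).
Proof.
move=> hN; rewrite /oneline (_ : iota 1 N = rcons (iota 1 N.-1) N).
  by rewrite map_rcons last_rcons pchar_Zp.
by rewrite -{1}(prednK (ltnW hN)) iotaSr add1n prednK // ltnW.
Qed.

Lemma prev_insert (T : eqType) (h x y z : T) u v :
  uniq (u ++ z :: v) -> x \in u ++ z :: v -> x != y -> x != z ->
  prev (h :: u ++ y :: z :: v) x = prev (h :: u ++ z :: v) x.
Proof.
move=> U + xy xz; rewrite mem_cat inE (negPf xz) => /orP[] /splitPr xs.
  case: xs U => w1 w2; rewrite -!catA => U.
  have xw : x \notin w1.
    by move: U; rewrite cat_uniq => /and3P[_ /norP[]].
  by rewrite !prev_cat_cons.
case: xs U => w1 w2; rewrite -[z :: _ ++ _]cat_cons catA => U.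
have : x \notin u ++ z :: w1.
  by move: U; rewrite cat_uniq => /and3P[_ /norP[]].
rewrite mem_cat inE => /norP[xu /norP[_ xw]].
rewrite -[y :: _ ++ _]cat_cons catA !prev_cat_cons ?mem_cat ?inE ?negb_or
  ?xu ?xy ?xz ?xw //.
by rewrite !last_cat.
Qed.

(** Each arrow of [breakpoint_cyc t] into [t 0] becomes a detour through 0 and then [m + 1] before
    reaching [t 0]; all other arrows are kept. *)
Lemma breakpoint_contraction m (s : {perm 'Z_m.+1}) (t : {perm 'Z_m}) u v :
  (1 < m)%N -> oneline s = u ++ m.+1 :: 1%N :: v -> oneline t = u ++ 1%N :: v ->
  let e (r : 'Z_m) : 'I_m.+2 := inord (label r) in
  [/\ breakpoint_perm s ord0 = ord_max,
      breakpoint_perm s ord_max = e (t 0) &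
      forall r, breakpoint_perm s (e r) =
        if breakpoint_cyc t r == t 0 then ord0 else e (breakpoint_cyc t r)].
Proof.
move=> hm es et e; have hm1 : (1 < m.+1)%N by lia.
have us : uniq (0%N :: oneline s) by rewrite cons_uniq oneline_uniq // mem_oneline.
have ut : uniq (0%N :: oneline t) by rewrite cons_uniq oneline_uniq // mem_oneline.
have ve (r : 'Z_m) : e r = label r :> nat.
  by rewrite inordK //; have := label_le r hm; lia.
have Nu : m.+1 \notin u.
  have := mem_oneline t m.+1 hm; rewrite et mem_cat ltnn andbF => /negbT.
  by rewrite negb_or => /andP[].
have u1 : 1%N \notin u.
  by have := oneline_uniq t hm; rewrite et cat_uniq /= negb_or -!andbA => /and3P[].
have pN : prev (0%N :: oneline s) m.+1 = prev (0%N :: oneline t) 1%N.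
  by rewrite es et !prev_cat_cons.
have p1 : prev (0%N :: oneline s) 1%N = m.+1.
  rewrite es -cat_rcons prev_cat_cons ?last_rcons // mem_rcons inE negb_or u1.
  by rewrite andbT; lia.
have px x : x \in oneline t -> x != 1%N ->
    prev (0%N :: oneline s) x = prev (0%N :: oneline t) x.
  move=> xt x1; rewrite es et; apply: prev_insert => //; rewrite -?et //.
    exact: oneline_uniq.
  by apply: contraTneq xt => ->; rewrite mem_oneline // ltnn andbF.
split.
- by apply: ord_inj; rewrite val_breakpoint // p1.
- apply: ord_inj; rewrite val_breakpoint // eqxx ve -last_oneline //.
  rewrite prev_cons_head; last by case/andP: us.
  by rewrite es et !last_cat.
move=> r; apply: ord_inj; rewrite val_breakpoint // ve.
have -> : (label r == m.+1) = false by have := label_le r hm; lia.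
have -> : prev (0%N :: oneline s) (label r).+1 =
    prev (0%N :: oneline t) (label (r + 1)).
  (* Integer and cyclic successors differ only at [r = 0], where they are [m + 1] and 1; there
     [m + 1] has in [s] the predecessor that 1 has in [t]. *)
  have [r0|r0] := eqVneq r 0.
    have -> : label r = m by rewrite /label r0 eqxx.
    by rewrite r0 add0r pN -[1 in RHS]/(1%:R) label_natr // ltnW.
  have lr : (label r < m)%N.
    rewrite ltn_neqAle label_le // andbT; apply: contraNneq r0 => e0.
    by rewrite -(labelK hm r) e0 pchar_Zp.
  have -> : label (r + 1) = (label r).+1.
    by rewrite -{1}(labelK hm r) natr1 label_natr.
  by rewrite px ?mem_oneline // eqSS; have := label_gt0 r hm; lia.
rewrite -{1}(permKV t (r + 1)) prev_oneline // /breakpoint_cyc (inj_eq perm_inj).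
by rewrite subr_eq0; case: eqP => // _; rewrite ve.
Qed.

Lemma breakpoint_cyc_inj N (t : {perm 'Z_N}) : injective (breakpoint_cyc t).
Proof. by move=> x y /perm_inj/addIr/perm_inj/addIr. Qed.

(** Lengthening one arrow by the two extra points does not change whether there is a single
    cycle. *)
Lemma strategic_pile_contraction m (s : {perm 'Z_m.+1}) (t : {perm 'Z_m}) u v :
  (1 < m)%N -> oneline s = u ++ m.+1 :: 1%N :: v -> oneline t = u ++ 1%N :: v ->
  #|strategic_pile s| = m <-> forall x y, fconnect (breakpoint_cyc t) x y.
Proof.
move=> hm es et; pose e (r : 'Z_m) : 'I_m.+2 := inord (label r).
have [C0 CN Ce] : [/\ _ = _, _ = e (t 0) & forall r : 'Z_m,
    _ (e r) = if _ == _ then _ else e _] := breakpoint_contraction hm es et.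
have hm1 : (1 < m.+1)%N by lia.
rewrite -[m in X in X <-> _]/(m.+1.-1) card_strategic_pile_max //.
set C := breakpoint_perm s in C0 CN Ce *; set D := breakpoint_cyc t in Ce *.
have ve (r : 'Z_m) : e r = label r :> nat.
  by rewrite inordK //; have := label_le r hm; lia.
split=> [[_ conn]|conn].
  (* Collapsing the detour onto its endpoint [t 0] turns each step of [C] into zero or one step of
     [D]. *)
  pose h (x : 'I_m.+2) : 'Z_m := if (x == ord0) || (x == ord_max) then t 0 else x%:R.
  have he r : h (e r) = r.
    rewrite /h -!val_eqE [val (e r)]ve ve labelK //=.
    have := label_gt0 r hm; have := label_le r hm; case: ifP => //; lia.
  have step x : fconnect D (h x) (h (C x)).
    have [->|x0] := eqVneq x ord0; first by rewrite C0 /h !eqxx ?orbT connect0.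
    have [->|xN] := eqVneq x ord_max; first by rewrite CN he /h eqxx orbT connect0.
    have -> : x = e x%:R.
      apply: ord_inj; rewrite ve label_natr //.
      move: x0 xN (ltn_ord x); rewrite -!val_eqE /=; lia.
    rewrite Ce he; case: eqP => [eD|_]; last by rewrite he fconnect1.
    by rewrite /h eqxx -eD fconnect1.
  have base x : fconnect D (t 0) x.
    rewrite -[x]he -(iter_findex (conn (e x))).
    elim: (findex _ _ _) => [|k IHk]; first by rewrite /h eqxx orbT connect0.
    by apply: connect_trans IHk _; rewrite iterS.
  move=> x y; apply: connect_trans (base y).
  by rewrite fconnect_sym //; exact: breakpoint_cyc_inj.
split=> //.
(* An orbit of [D] from [t 0] lifts to [C] arrow by arrow; whenever it returns to [t 0], that point
   is already known to be reached. *)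
have conn_e r : fconnect C ord_max (e r).
  have ct : fconnect C ord_max (e (t 0)) by rewrite -CN fconnect1.
  rewrite -(iter_findex (conn (t 0) r)); elim: (findex _ _ _) => [//|k IHk].
  rewrite iterS; have [->//|ne] := eqVneq (D (iter k D (t 0))) (t 0).
  by apply: connect_trans IHk _; have := Ce (iter k D (t 0));
    rewrite (negPf ne) => <-; exact: fconnect1.
move=> x; have [->|x0] := eqVneq x ord0.
  (* The residue [t 1 - 1] is the one that [D] sends to [t 0], so [C] sends it to 0. *)
  apply: connect_trans (conn_e (t 1 - 1)) _.
  have := Ce (t 1 - 1); rewrite /D /breakpoint_cyc subrK permK subrr eqxx => <-.
  exact: fconnect1.
have [->|xN] := eqVneq x ord_max; first exact: connect0.
have -> : x = e x%:R; last exact: conn_e.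
apply: ord_inj; rewrite ve label_natr //.
move: x0 xN (ltn_ord x); rewrite -!val_eqE /=; lia.
Qed.

(** * Interlacing letters in words *)

(** The test of [valid_pointer_context], freed from pointers so that it also applies to words of
    residues. *)
Definition crossing (T : eqType) (w : seq T) (p q : T) : bool :=
  let occ := [seq r <- w | (r == p) || (r == q)] in
  (p != q) && ((occ == [:: p; q; p; q]) || (occ == [:: q; p; q; p])).

Lemma crossing_sym (T : eqType) (w : seq T) p q : crossing w p q = crossing w q p.
Proof.
rewrite /crossing eq_sym orbC; congr (_ && _).
by rewrite (eq_filter (a2 := fun r => (r == q) || (r == p))) // => r; rewrite orbC.
Qed.

Lemma crossing_map (T U : eqType) (f : T -> U) (w : seq T) p q :
  injective f -> crossing (map f w) (f p) (f q) = crossing w p q.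
Proof.
move=> fI; rewrite /crossing (inj_eq fI) filter_map.
rewrite (eq_filter (a2 := fun r => (r == p) || (r == q))); last first.
  by move=> r /=; rewrite !(inj_eq fI).
have E x y z t : [:: f x; f y; f z; f t] = map f [:: x; y; z; t] by [].
by rewrite !E !(inj_eq (inj_map fI)).
Qed.

(** Moving one letter from front to back either leaves the occurrence list alone or rotates it by
    one, which exchanges the two alternating patterns. *)
Lemma crossing_catC (T : eqType) (w1 w2 : seq T) p q :
  crossing (w1 ++ w2) p q = crossing (w2 ++ w1) p q.
Proof.
elim: w1 w2 => [|x w1 IHw] w2; first by rewrite cats0.
rewrite -cat_rcons -IHw -rcons_cat cat_cons /crossing filter_rcons /=.
congr (_ && _); case: ifP => // _; rewrite -rot1_cons.
have E (y z : T) l : (rot 1 l == [:: y; z; y; z]) = (l == [:: z; y; z; y]).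
  by rewrite -(inj_eq (@rot_inj 1 T) l).
by rewrite !E orbC.
Qed.

(** * Pointer contexts as crossings in a word over residues *)

(** The letter [r] encodes the pointer from [r] to [r + 1], so an entry contributes its left and
    then its right pointer. *)
Definition cyc_word N (t : {perm 'Z_N}) : seq 'Z_N :=
  flatten [seq [:: t i%:R - 1; t i%:R] | i <- iota 1 N].

(** The adjacent entries [m + 1] and 1 of [s] have four pointers, the middle two of which are
    deleted. What is left, [(m, m + 1)] and [(1, 2)], matches the letters 0 and 1 of the entry 1 of
    [t], since 0 has label [m]. *)
Lemma pointer_word_contraction m (s : {perm 'Z_m.+1}) (t : {perm 'Z_m}) u v :
  (1 < m)%N -> oneline s = u ++ m.+1 :: 1%N :: v -> oneline t = u ++ 1%N :: v ->
  pointer_word s = [seq right_pointer (label r) | r <- cyc_word t].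
Proof.
move=> hm es et.
pose G k := if k == 1%N then [:: left_pointer m.+1; right_pointer 1]
            else [:: left_pointer k; right_pointer k].
transitivity (flatten [seq G k | k <- oneline t]); last first.
  rewrite map_flatten /oneline -!map_comp; congr flatten; apply/eq_map => i /=.
  rewrite /G; have [e1|ne1] := eqVneq (label _) 1%N.
    rewrite -[t i%:R](labelK hm) e1 subrr.
    have -> : label (0 : 'Z_m) = m by rewrite /label eqxx.
    by rewrite label_natr ?(ltnW hm).
  congr [:: _; _]; rewrite /left_pointer /right_pointer.
  have l0 := label_gt0 (t i%:R) hm; have lm := label_le (t i%:R) hm.
  have -> : label (t i%:R - 1) = (label (t i%:R)).-1; last by rewrite prednK.
  rewrite -{1}[t i%:R](labelK hm) -{1}(prednK l0) -natr1 addrK label_natr //.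
  by move: l0 lm ne1; move: (label _) => l; lia.
rewrite /pointer_word filter_flatten -map_comp es et !map_cat !flatten_cat /=.
have G1 w : {subset w <= oneline t} -> 1%N \notin w ->
   flatten [seq [seq p <- [:: left_pointer k; right_pointer k]
     | (p != (0, 1)%N) && (p != (m.+1, m.+2))] | k <- w] =
   flatten [seq G k | k <- w].
  move=> sw w1; congr flatten; apply/eq_in_map => k kw.
  have := sw _ kw; rewrite mem_oneline // => /andP[k0 km].
  have k1 : k != 1%N by apply: contraNneq w1 => <-.
  rewrite /G (negPf k1) /= /left_pointer /right_pointer !xpair_eqE.
  rewrite (_ : (k == 1)%N = false) ?(negPf k1) // (_ : (k == 0)%N = false); last lia.
  rewrite !andbF /= (_ : (k.-1 == m.+1)%N = false); last lia.
  by rewrite (_ : (k == m.+1)%N = false) //; lia.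
have U := oneline_uniq t hm; rewrite et in U.
have [u1 v1] : 1%N \notin u /\ 1%N \notin v.
  by move: U; rewrite cat_uniq /= => /and3P[_ /norP[? _] /andP[? _]].
rewrite (G1 u) // ?(G1 v) //; last 2 first.
- by move=> k kv; rewrite et mem_cat inE kv !orbT.
- by move=> k ku; rewrite et mem_cat ku.
rewrite /left_pointer /right_pointer !xpair_eqE /=.
rewrite !eqxx (_ : (m == 0)%N = false); last lia.
rewrite (_ : (m == m.+1)%N = false); last lia.
by rewrite (_ : (1 == m.+1)%N = false) //; lia.
Qed.

(* Pairs are ordered, so each context is counted twice. *)
Definition num_crossings N (t : {perm 'Z_N}) :=
  #|[set d : 'Z_N * 'Z_N | crossing (cyc_word t) d.1 d.2]|.

(** Translating residues does not preserve the order of labels, whence the count over ordered pairs.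
    It splits into [A], which labels match with the contexts of [s], and its mirror image [B]. *)
Lemma num_contexts_contraction m (s : {perm 'Z_m.+1}) (t : {perm 'Z_m}) u v :
  (1 < m)%N -> oneline s = u ++ m.+1 :: 1%N :: v -> oneline t = u ++ 1%N :: v ->
  num_crossings t = (num_contexts s).*2.
Proof.
move=> hm es et.
pose A := [set d : 'Z_m * 'Z_m |
  (label d.1 < label d.2)%N && crossing (cyc_word t) d.1 d.2].
pose B := [set d : 'Z_m * 'Z_m |
  (label d.2 < label d.1)%N && crossing (cyc_word t) d.1 d.2].
have fI : injective (fun r : 'Z_m => right_pointer (label r)).
  by move=> x y [] /(label_inj hm).
have cA : #|A| = num_contexts s.
  pose e (r : 'Z_m) : 'I_m.+1 := inord (label r).
  have ve (r : 'Z_m) : e r = label r :> nat by rewrite inordK // ltnS label_le.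
  have eI : injective (fun d : 'Z_m * 'Z_m => (e d.1, e d.2)).
    move=> [x1 x2] [y1 y2] [] /(congr1 val) /= + /(congr1 val) /=.
    by rewrite !ve => /(label_inj hm)-> /(label_inj hm)->.
  rewrite -(card_imset _ eI) /num_contexts; apply: eq_card => c.
  apply/imsetP/idP => [[d + ->]|].
    rewrite !inE /= !ve => /andP[-> cr]; rewrite label_gt0 //=.
    by rewrite /valid_pointer_context (pointer_word_contraction hm es et)
      -/(crossing _ _ _) crossing_map.
  rewrite inE => /andP[/andP[c0 c12]].
  rewrite /valid_pointer_context (pointer_word_contraction hm es et) -/(crossing _ _ _).
  have l1 : label (c.1%:R : 'Z_m) = c.1.
    by rewrite label_natr // c0 /= -ltnS (leq_trans c12 (ltnW (ltn_ord c.2))).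
  have l2 : label (c.2%:R : 'Z_m) = c.2.
    by rewrite label_natr // (leq_ltn_trans _ c12) //= -ltnS ltn_ord.
  rewrite -{1}l1 -{1}l2 (crossing_map _ _ _ fI) => cr.
  exists (c.1%:R, c.2%:R); first by rewrite inE /= l1 l2 c12.
  by rewrite [LHS]surjective_pairing; congr pair; apply: ord_inj; rewrite ve ?l1 ?l2.
have cB : #|B| = #|A|.
  have swI : injective (fun d : 'Z_m * 'Z_m => (d.2, d.1)) by move=> [? ?] [? ?] [-> ->].
  rewrite -(card_imset _ swI); apply: eq_card => -[x y]; rewrite !inE /=.
  apply/imsetP/idP => [[[x' y'] + [-> ->]]|xy]; first by rewrite inE /= crossing_sym.
  by exists (y, x) => //; rewrite inE /= crossing_sym.
rewrite -addnn -cA -{2}cB -cardsUI (_ : A :&: B = set0) ?cards0 ?addn0.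
  apply: eq_card => -[x y]; rewrite !inE /= -andb_orl.
  have [/(label_inj hm) ->|] := eqVneq (label x) (label y).
    by rewrite /crossing eqxx /= andbF.
  by rewrite neq_ltn => ->.
by apply/setP => -[x y]; rewrite !inE /=; case: ltngtP => //= _; rewrite ?andbF.
Qed.

(** * Invariance under [phi] *)

(** The shift [a] enters once through the inverse and once through the permutation, with opposite
    signs, and cancels. *)
Lemma breakpoint_cyc_phi N (a b : 'Z_N) (t : {perm 'Z_N}) r :
  breakpoint_cyc (phi a b t) (r + b) = breakpoint_cyc t r + b.
Proof.
rewrite /breakpoint_cyc; have -> : r + b + 1 = phi a b t ((t^-1)%g (r + 1) + a).
  by rewrite permE addrK permKV addrAC.
by rewrite permK permE addrAC addrK.
Qed.

Lemma fconnect_breakpoint_phi N (a b : 'Z_N) (t : {perm 'Z_N}) :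
  (forall x y, fconnect (breakpoint_cyc t) x y) ->
  forall x y, fconnect (breakpoint_cyc (phi a b t)) x y.
Proof.
move=> conn x y; rewrite -[x](subrK b) -[y](subrK b).
rewrite -(iter_findex (conn (x - b) (y - b))).
elim: (findex _ _ _) => [|k IHk]; first exact: connect0.
by apply: connect_trans IHk _; rewrite iterS -(breakpoint_cyc_phi a) fconnect1.
Qed.

(** Shifting the index rotates the concatenation by whole blocks; the induction shifts by one block
    at a time. *)
Lemma crossing_rotate N (T : eqType) (F : 'Z_N -> seq T) (a : 'Z_N) p q :
  (1 < N)%N ->
  crossing (flatten [seq F (i%:R - a) | i <- iota 1 N]) p q =
  crossing (flatten [seq F i%:R | i <- iota 1 N]) p q.
Proof.
move=> hN; rewrite -(natr_Zp a).
elim: (nat_of_ord a) => [|k IHk].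
  by under eq_map do rewrite subr0.
rewrite -{}IHk.
have -> : [seq F (i%:R - k.+1%:R) | i <- iota 1 N] =
    [seq F (i%:R - k%:R) | i <- iota 0 N].
  rewrite -[1%N]addn0 iotaDl -map_comp; apply: eq_map => i /=.
  by rewrite add1n -![_.+1%:R]natr1 [k%:R + 1]addrC addrKA.
(* The two index ranges differ only in having 0 in front or [N] at the end, and these are the same
   residue. *)
have [N' [-> ->]] : exists N', iota 0 N = 0%N :: N' /\ iota 1 N = rcons N' N.
  exists (iota 1 N.-1); rewrite -{1}(prednK (ltnW hN)) //; split=> //.
  by rewrite -{1}(prednK (ltnW hN)) iotaSr add1n prednK // ltnW.
rewrite map_rcons flatten_rcons /= crossing_catC.
by rewrite pchar_Zp.
Qed.

(** Adding [b] to both letters is a bijection between the two sets of crossing pairs. *)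
Lemma num_crossings_phi N (a b : 'Z_N) (t : {perm 'Z_N}) : (1 < N)%N ->
  num_crossings (phi a b t) = num_crossings t.
Proof.
move=> hN.
have fI : injective (fun d : 'Z_N * 'Z_N => (d.1 + b, d.2 + b)).
  by move=> [x1 x2] [y1 y2] /pair_equal_spec[/= /addIr-> /addIr->].
rewrite /num_crossings -[RHS](card_imset _ fI); apply: eq_card => -[x y].
have E p q : crossing (cyc_word (phi a b t)) (p + b) (q + b) =
    crossing (cyc_word t) p q.
  rewrite -[RHS](crossing_map _ _ _ (@addIr _ b)) map_flatten -map_comp.
  rewrite -[RHS](@crossing_rotate N _ (fun x => [:: t x - 1 + b; t x + b]) a) //.
  congr crossing; congr flatten; apply: eq_map => i.
  by rewrite permE [_ + b - 1]addrAC.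
rewrite inE /= -{1}[x](subrK b) -{1}[y](subrK b) E.
apply/idP/imsetP => [cr|[d + [-> ->]]]; last by rewrite inE !addrK.
by exists (x - b, y - b); rewrite ?inE //= !subrK.
Qed.

(** * Passing between permutations and their contractions *)

Lemma rem_cat_cons (T : eqType) (x : T) u v :
  x \notin u -> rem x (u ++ x :: v) = u ++ v.
Proof.
elim: u => [|y u IHu] /=; first by rewrite eqxx.
by rewrite inE eq_sym => /norP[/negPf-> /IHu->].
Qed.

Lemma expansion_exists m (t : {perm 'Z_m}) : (1 < m)%N ->
  exists (s : {perm 'Z_m.+1}) u v,
    oneline s = u ++ m.+1 :: 1%N :: v /\ oneline t = u ++ 1%N :: v.
Proof.
move=> hm; have : 1%N \in oneline t by rewrite mem_oneline ?(ltnW hm).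
move=> /splitPr t1; move: (erefl (oneline t)); case: {2}_ / t1 => u v et.
have pt : perm_eq (u ++ 1%N :: v) (iota 1 m).
  rewrite -et; apply: uniq_perm; rewrite ?oneline_uniq ?iota_uniq // => i.
  by rewrite mem_oneline // mem_iota.
have [|s es] := @oneline_onto m.+1 (u ++ m.+1 :: 1%N :: v) (ltnW hm).
  rewrite iotaSr add1n perm_sym perm_rcons perm_sym.
  by rewrite -cat1s perm_catCA cat1s perm_cons.
by exists s, u, v.
Qed.

(** A maximal pile forces the breakpoint permutation to send 0 to [m + 1], which says that [m + 1]
    is the predecessor of 1. *)
Lemma contraction_split m (s : {perm 'Z_m.+1}) (t : {perm 'Z_m}) : (1 < m)%N ->
  #|strategic_pile s| = m -> oneline t = rem m.+1 (oneline s) ->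
  exists u v, oneline s = u ++ m.+1 :: 1%N :: v /\ oneline t = u ++ 1%N :: v.
Proof.
move=> hm; rewrite -[m in X in X -> _]/(m.+1.-1) => /card_strategic_pile_max.
have hm1 := ltnW hm; case=> // /(congr1 (@nat_of_ord _)) C0 _ ->.
have {C0} : prev (0%N :: oneline s) 1 = m.+1 by rewrite -[RHS]C0 val_breakpoint.
have U := oneline_uniq s hm1.
have : 1%N \in oneline s by rewrite mem_oneline.
move=> /splitPr s1; move: (erefl (oneline s)); case: {2}_ / s1 => u' v es.
rewrite {}es in U *.
have u1 : 1%N \notin u'.
  by move: U; rewrite cat_uniq => /and3P[_ /norP[]].
(* If 1 came first, its predecessor would be the leading 0 and not [m + 1]. *)
rewrite prev_cat_cons //; case/lastP: u' U {u1} => [//|u x].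
rewrite last_rcons => U ex; rewrite {}ex cat_rcons in U *; exists u, v; split=> //.
by rewrite rem_cat_cons //; move: U; rewrite cat_uniq => /and3P[_ /norP[]].
Qed.

Theorem theorem3p3 (n k : nat) (hn : (2 <= n)%N) (a b : 'Z_(2 * n - 1))
    (s : {perm 'Z_(2 * n - 1)}) :
  s \in M n k -> phi a b s \in M n k.
Proof.
rewrite !inE => /existsP[w]; rewrite /max_strategic_pile /is_contraction.
have hm : (1 < 2 * n - 1)%N by lia.
have eN : (2 * n = (2 * n - 1).+1)%N by lia.
(* Generalizing both sizes makes the types match the lemmas on [m] and [m.+1] literally. *)
move: (2 * n - 1)%N hm eN a b s w => m hm.
move: (2 * n)%N => N eN; subst N => a b t s.
case/and3P => /eqP mp /eqP <- /eqP ct; apply/existsP.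
have [u [v [es et]]] := contraction_split hm mp ct.
have [s' [u' [v' [es' et']]]] := expansion_exists (phi a b t) hm.
exists s'; apply/and3P; split; apply/eqP.
- apply/(strategic_pile_contraction hm es' et')/fconnect_breakpoint_phi.
  exact/(strategic_pile_contraction hm es et).
- apply: double_inj; rewrite -(num_contexts_contraction hm es' et').
  by rewrite num_crossings_phi // (num_contexts_contraction hm es et).
(* [rem] deletes the first occurrence, so [m + 1] must be absent from [u']; it exceeds every entry
   of the contraction. *)
rewrite et' es' rem_cat_cons //.
have := mem_oneline (phi a b t) m.+1 hm.
by rewrite et' mem_cat ltnn andbF => /negbT/norP[].
Qed.
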